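(* The assignment sending a finite-dimensional pre-Lie algebra $(A,\cdot)$ to the $\mathcal O$-operator $\mathrm{id}_A:A\to\mathfrak g(A)$ on its sub-adjacent Lie algebra $\mathfrak g(A)$ associated to the representation $(A,L)$, and sending a pre-Lie algebra homomorphism $\phi:(A,\cdot_A)\to(B,\cdot_B)$ to the pair $(\phi,\phi):\mathrm{id}_A\to\mathrm{id}_B$, defines a functor $F$ from the category $\mathbf{PL}$ of pre-Lie algebras to the category $\mathbf{OP}$ of $\mathcal O$-operators.
   Context: All spaces are finite dimensional over a field $K$. A pre-Lie algebra is a vector space $A$ with a bilinear product $\cdot$ such that $x\cdot(y\cdot z)-(x\cdot y)\cdot z=y\cdot(x\cdot z)-(y\cdot x)\cdot z$ for all $x,y,z\in A$. A homomorphism of pre-Lie algebras is a linear map preserving the products; $\mathbf{PL}$ is the resulting category. The sub-adjacent Lie algebra $\mathfrak g(A)$ is $A$ with bracket $[a,b]=a\cdot b-b\cdot a$. $L:A\to\mathrm{End}(A)$, $L(a)b=a\cdot b$, is a representation of $\mathfrak g(A)$ on $A$. An $\mathcal O$-operator on a Lie algebra $\mathfrak g$ associated to a representation $(V,\rho)$ is a linear map $T:V\to\mathfrak g$ with $[T(u),T(v)]=T(\rho(T(u))v-\rho(T(v))u)$ for all $u,v\in V$. A (coherent) homomorphism of $\mathcal O$-operators from $T_{\mathfrak g}:V_{\mathfrak g}\to\mathfrak g$ (associated to $(V_{\mathfrak g},\rho_{\mathfrak g})$) to $T_{\mathfrak h}:V_{\mathfrak h}\to\mathfrak h$ (associated to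 $(V_{\mathfrak h},\rho_{\mathfrak h})$) is a pair $(\phi,\alpha)$ with $\phi:\mathfrak g\to\mathfrak h$ a Lie algebra homomorphism and $\alpha:V_{\mathfrak g}\to V_{\mathfrak h}$ linear such that $\alpha(\rho_{\mathfrak g}(x)v)=\rho_{\mathfrak h}(\phi(x))(\alpha(v))$ for all $x\in\mathfrak g,v\in V_{\mathfrak g}$, and $T_{\mathfrak h}\alpha=\phi T_{\mathfrak g}$. $\mathbf{OP}$ is the category of $\mathcal O$-operators with these morphisms (composed componentwise). *)

(* Defs.v *)
From HB Require Import structures.
From mathcomp Require Import all_boot all_order all_algebra.
From mathcomp Require Import boolp.

Set Implicit Arguments.
Unset Strict Implicit.
Unset Printing Implicit Defensive.

Import GRing.Theory.
Local Open Scope ring_scope.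

(* Composition is in applicative order: [cat_comp g f] is "g after f". *)
Record category := Category {
  cat_obj :> Type;
  cat_hom : cat_obj -> cat_obj -> Type;
  cat_id : forall X, cat_hom X X;
  cat_comp : forall X Y Z, cat_hom Y Z -> cat_hom X Y -> cat_hom X Z;
  cat_comp1m : forall X Y (f : cat_hom X Y), cat_comp (cat_id Y) f = f;
  cat_compm1 : forall X Y (f : cat_hom X Y), cat_comp f (cat_id X) = f;
  cat_compA : forall X Y Z W
      (h : cat_hom Z W) (g : cat_hom Y Z) (f : cat_hom X Y),
    cat_comp h (cat_comp g f) = cat_comp (cat_comp h g) f
}.

Arguments cat_hom {c} X Y.
Arguments cat_id {c} X.
Arguments cat_comp {c X Y Z} g f.

Definition is_functor (C D : category) (Fobj : C -> D)
    (Fhom : forall X Y : C, cat_hom X Y -> cat_hom (Fobj X) (Fobj Y)) : Prop :=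
  (forall X : C, Fhom X X (cat_id X) = cat_id (Fobj X)) /\
  (forall (X Y Z : C) (g : cat_hom Y Z) (f : cat_hom X Y),
     Fhom X Z (cat_comp g f) = cat_comp (Fhom Y Z g) (Fhom X Y f)).

Arguments is_functor {C D} Fobj Fhom.

(* In all the structures below, [vectType K] makes the underlying spaces
   finite dimensional. *)

Record preLieAlgebra (K : fieldType) := PreLieAlgebra {
  pl_space :> vectType K;
  pl_mul : {bilinear pl_space -> pl_space -> pl_space};
  pl_mulP : forall x y z,
    pl_mul x (pl_mul y z) - pl_mul (pl_mul x y) z =
    pl_mul y (pl_mul x z) - pl_mul (pl_mul y x) z
}.

(* Since the characteristic is arbitrary, the bracket is required to be
   alternating, and not just antisymmetric. *)
Record lieAlgebra (K : fieldType) := LieAlgebra {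
  lie_space :> vectType K;
  lie_br : {bilinear lie_space -> lie_space -> lie_space};
  lie_brxx : forall x, lie_br x x = 0;
  lie_jacobi : forall x y z,
    lie_br x (lie_br y z) + lie_br y (lie_br z x) + lie_br z (lie_br x y) = 0
}.

Record representation (K : fieldType) (g : lieAlgebra K) := Representation {
  rep_space :> vectType K;
  rep_map : {linear g -> 'End(rep_space)};
  rep_mapP : forall x y,
    rep_map (lie_br g x y) =
    (rep_map x \o rep_map y)%VF - (rep_map y \o rep_map x)%VF
}.

Definition O_operator_axiom (K : fieldType) (g : lieAlgebra K)
    (V : representation g) (T : 'Hom(V, g)) : Prop :=
  forall u v : V,
    lie_br g (T u) (T v) = T (rep_map V (T u) v - rep_map V (T v) u).

Record O_operator (K : fieldType) := OOperator {
  op_lie : lieAlgebra K;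
  op_rep : representation op_lie;
  op_map : 'Hom(op_rep, op_lie);
  op_mapP : O_operator_axiom op_map
}.

Definition preLie_hom_axiom (K : fieldType) (A B : preLieAlgebra K)
    (phi : 'Hom(A, B)) : Prop :=
  forall x y : A, phi (pl_mul A x y) = pl_mul B (phi x) (phi y).

Record preLie_hom (K : fieldType) (A B : preLieAlgebra K) := PreLieHom {
  plh_map : 'Hom(A, B);
  plh_mapP : preLie_hom_axiom plh_map
}.

Definition lie_hom_axiom (K : fieldType) (g h : lieAlgebra K)
    (phi : 'Hom(g, h)) : Prop :=
  forall x y : g, phi (lie_br g x y) = lie_br h (phi x) (phi y).

Definition O_operator_hom_axiom (K : fieldType) (S T : O_operator K)
    (phi : 'Hom(op_lie S, op_lie T)) (alpha : 'Hom(op_rep S, op_rep T)) : Prop :=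
  [/\ lie_hom_axiom phi,
      forall (x : op_lie S) (v : op_rep S),
        alpha (rep_map (op_rep S) x v) = rep_map (op_rep T) (phi x) (alpha v)
    & (op_map T \o alpha)%VF = (phi \o op_map S)%VF].

Record O_operator_hom (K : fieldType) (S T : O_operator K) := OOperatorHom {
  oph_lie : 'Hom(op_lie S, op_lie T);
  oph_rep : 'Hom(op_rep S, op_rep T);
  oph_P : O_operator_hom_axiom oph_lie oph_rep
}.

Section PL.
Variable K : fieldType.
Implicit Types A B C D : preLieAlgebra K.

Lemma preLie_hom_eq A B (f g : preLie_hom A B) :
  plh_map f = plh_map g -> f = g.
Proof.
case: f g => [f fP] [g gP] /= fg.
by case: _ / fg gP => gP; rewrite (Prop_irrelevance fP gP).
Qed.

Lemma preLie_id_axiom A : preLie_hom_axiom (A := A) (B := A) \1%VF.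
Proof. by move=> x y; rewrite !id_lfunE. Qed.

Lemma preLie_comp_axiom A B C (g : preLie_hom B C) (f : preLie_hom A B) :
  preLie_hom_axiom (A := A) (B := C) (plh_map g \o plh_map f)%VF.
Proof. by move=> x y; rewrite !comp_lfunE (plh_mapP f) (plh_mapP g). Qed.

Definition preLie_id A : preLie_hom A A := PreLieHom (@preLie_id_axiom A).

Definition preLie_comp A B C (g : preLie_hom B C) (f : preLie_hom A B) :
  preLie_hom A C := PreLieHom (preLie_comp_axiom g f).

Lemma preLie_comp1m A B (f : preLie_hom A B) : preLie_comp (preLie_id B) f = f.
Proof. by apply: preLie_hom_eq; exact: comp_lfun1l. Qed.

Lemma preLie_compm1 A B (f : preLie_hom A B) : preLie_comp f (preLie_id A) = f.
Proof. by apply: preLie_hom_eq; exact: comp_lfun1r. Qed.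

Lemma preLie_compA A B C D
    (h : preLie_hom C D) (g : preLie_hom B C) (f : preLie_hom A B) :
  preLie_comp h (preLie_comp g f) = preLie_comp (preLie_comp h g) f.
Proof. by apply: preLie_hom_eq; exact: comp_lfunA. Qed.

Definition PL : category := Category preLie_comp1m preLie_compm1 preLie_compA.

End PL.

Section OP.
Variable K : fieldType.
Implicit Types Q R S T : O_operator K.

Lemma O_operator_hom_eq S T (f g : O_operator_hom S T) :
  oph_lie f = oph_lie g -> oph_rep f = oph_rep g -> f = g.
Proof.
case: f g => [f a fP] [g b gP] /= fg ab.
by case: _ / fg gP => gP; case: _ / ab gP => gP; rewrite (Prop_irrelevance fP gP).
Qed.

Lemma O_operator_id_axiom S : O_operator_hom_axiom (S := S) (T := S) \1%VF \1%VF.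
Proof.
split=> [x y|x v|]; rewrite ?id_lfunE //.
by rewrite comp_lfun1l comp_lfun1r.
Qed.

Lemma O_operator_comp_axiom R S T
    (g : O_operator_hom S T) (f : O_operator_hom R S) :
  O_operator_hom_axiom (S := R) (T := T)
    (oph_lie g \o oph_lie f)%VF (oph_rep g \o oph_rep f)%VF.
Proof.
case: g f => [g b [gL gE gT]] [f a [fL fE fT]] /=.
split=> [x y|x v|]; rewrite ?comp_lfunE.
- by rewrite fL gL.
- by rewrite fE gE.
- by rewrite comp_lfunA gT -comp_lfunA fT comp_lfunA.
Qed.

Definition O_operator_id S : O_operator_hom S S :=
  OOperatorHom (O_operator_id_axiom S).

Definition O_operator_comp R S T
    (g : O_operator_hom S T) (f : O_operator_hom R S) : O_operator_hom R T :=
  OOperatorHom (O_operator_comp_axiom g f).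

Lemma O_operator_comp1m S T (f : O_operator_hom S T) :
  O_operator_comp (O_operator_id T) f = f.
Proof. by apply: O_operator_hom_eq; exact: comp_lfun1l. Qed.

Lemma O_operator_compm1 S T (f : O_operator_hom S T) :
  O_operator_comp f (O_operator_id S) = f.
Proof. by apply: O_operator_hom_eq; exact: comp_lfun1r. Qed.

Lemma O_operator_compA Q R S T
    (h : O_operator_hom S T) (g : O_operator_hom R S) (f : O_operator_hom Q R) :
  O_operator_comp h (O_operator_comp g f) =
  O_operator_comp (O_operator_comp h g) f.
Proof. by apply: O_operator_hom_eq; exact: comp_lfunA. Qed.

Definition OP : category :=
  Category O_operator_comp1m O_operator_compm1 O_operator_compA.

End OP.

Section SubAdjacent.
Variables (K : fieldType) (A : preLieAlgebra K).

Definition commutator (a b : A) : A := pl_mul A a b - pl_mul A b a.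

Lemma commutator_bilinear : bilinear_for *:%R *:%R commutator.
Proof.
split=> x k u v; rewrite /commutator linearPl linearPr /=;
  by rewrite opprD addrACA -scalerBr.
Qed.

HB.instance Definition _ :=
  bilinear_isBilinear.Build K A A A *:%R *:%R commutator commutator_bilinear.

Lemma commutatorxx x : commutator x x = 0.
Proof. exact: subrr. Qed.

Lemma pl_mul_commutator x y z :
  pl_mul A (commutator x y) z =
  pl_mul A x (pl_mul A y z) - pl_mul A y (pl_mul A x z).
Proof.
have P := pl_mulP x y z; rewrite /commutator linearBl /=.
rewrite -[in RHS](subrK (pl_mul A (pl_mul A x y) z) (pl_mul A x _)) P.
by rewrite [RHS]addrC !addrA addNr add0r addrC.
Qed.

Lemma commutator_jacobi x y z :
  commutator x (commutator y z) + commutator y (commutator z x)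
  + commutator z (commutator x y) = 0.
Proof.
have E a b c : commutator a (commutator b c) =
    (pl_mul A a (pl_mul A b c) + pl_mul A c (pl_mul A b a))
    - (pl_mul A b (pl_mul A c a) + pl_mul A a (pl_mul A c b)).
  rewrite {1}/commutator pl_mul_commutator {1}/commutator linearBr /=.
  by rewrite opprB addrACA [- _ - _]addrC opprD.
rewrite (E x y z) (E y z x) (E z x y) !subrKA.
exact: subrr.
Qed.

Definition subadjacent : lieAlgebra K :=
  LieAlgebra (lie_br := commutator) commutatorxx commutator_jacobi.

Definition left_mul (a : subadjacent) : 'End(A) := linfun (pl_mul A a).

Lemma left_mul_linear : linear left_mul.
Proof.
move=> k a b; apply/lfunP=> v.
by rewrite add_lfunE scale_lfunE !lfunE /= linearPl.
Qed.

HB.instance Definition _ :=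
  GRing.isLinear.Build K subadjacent 'End(A) *:%R left_mul left_mul_linear.

Lemma left_mulP (x y : subadjacent) :
  left_mul (lie_br subadjacent x y) =
  (left_mul x \o left_mul y)%VF - (left_mul y \o left_mul x)%VF.
Proof.
apply/lfunP=> v; rewrite !(add_lfunE, opp_lfunE) !comp_lfunE !lfunE /=.
exact: pl_mul_commutator.
Qed.

Definition left_rep : representation subadjacent :=
  Representation (rep_map := left_mul) left_mulP.

End SubAdjacent.

(* Main.v *)
Require Import Defs.
From mathcomp Require Import all_boot all_order all_algebra.

(** For the identity map and the action by left multiplication, the O-operator identity is the
    definition of the commutator. Equivariance of [(phi, phi)] is multiplicativity of [phi], which
    with linearity also makes [phi] preserve commutators. *)

Lemma left_repE (K : fieldType) (A : preLieAlgebra K) (x : subadjacent A)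
    (v : left_rep A) :
  rep_map (left_rep A) x v = pl_mul A x v.
Proof. exact: lfunE. Qed.

Lemma id_O_operator (K : fieldType) (A : preLieAlgebra K) :
  O_operator_axiom (g := subadjacent A) (V := left_rep A) \1%VF.
Proof. by move=> u v; rewrite !id_lfunE !left_repE. Qed.

Lemma preLie_hom_subadjacent (K : fieldType) (A B : preLieAlgebra K)
    (phi : preLie_hom A B) :
  lie_hom_axiom (g := subadjacent A) (h := subadjacent B) (plh_map phi).
Proof.
move=> x y; rewrite /= /commutator.
by rewrite GRing.linearB /= !(plh_mapP phi).
Qed.

Theorem proposition4p19 (K : fieldType) :
  exists (idO : forall A : preLieAlgebra K,
            O_operator_axiom (g := subadjacent A) (V := left_rep A) \1%VF)
         (homO : forall (A B : preLieAlgebra K) (phi : preLie_hom A B),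
            O_operator_hom_axiom (S := OOperator (idO A))
              (T := OOperator (idO B)) (plh_map phi) (plh_map phi)),
    is_functor (C := PL K) (D := OP K)
      (fun A => OOperator (idO A))
      (fun A B phi => OOperatorHom (homO A B phi)).
Proof.
exists (@id_O_operator K).
unshelve eexists.
  move=> A B phi; split; first exact: preLie_hom_subadjacent.
    (* Through [left_repE], equivariance reads as multiplicativity of [phi]. *)
    by move=> x v; rewrite !left_repE (plh_mapP phi).
  by rewrite comp_lfun1l comp_lfun1r.
(* Identities and composites have the same underlying linear maps in both categories, so each
   component agrees by computation. *)
by split=> *; apply: O_operator_hom_eq.
Qed.
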